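(* Let $(V,\|\cdot\|)$ be a finite-dimensional real normed space and let $A^{bh}\colon GC_2(V)\to[0,\infty)$ be its two-dimensional Busemann--Hausdorff area density. Then $A^{bh}$ admits a convex extension to $\Lambda^2 V$; that is, there is a convex function $\Phi\colon\Lambda^2V\to\mathbb R$ such that $\Phi(\sigma)=A^{bh}(\sigma)$ for every simple $2$-vector $\sigma\in GC_2(V)$.
   Context: $\Lambda^2V$ is the second exterior power of $V$, and $GC_2(V)=\{v_1\wedge v_2: v_1,v_2\in V\}\subset\Lambda^2V$ is the Grassmannian cone, i.e. the set of all simple (decomposable) $2$-vectors. Let $B=\{v\in V:\|v\|\le1\}$ be the unit ball. The two-dimensional Busemann--Hausdorff area density is the function defined on simple $2$-vectors by $$A^{bh}(v_1\wedge v_2)=\frac{\pi}{m_2(L^{-1}(B))},$$ where $m_2$ is Lebesgue measure on $\mathbb R^2$ and $L\colon\mathbb R^2\to V$ is the linear map with $L(e_1)=v_1$, $L(e_2)=v_2$ for the standard basis $e_1,e_2$ of $\mathbb R^2$ (if $v_1,v_2$ are linearly dependent, then $m_2(L^{-1}(B))=\infty$ and the value is $0$). This value depends only on $v_1\wedge v_2$; it equals the two-dimensional Hausdorff measure, with respect to $\|\cdot\|$, of the parallelogram spanned by $v_1,v_2$. *)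

(* Defs.v *)
From HB Require Import structures.
From mathcomp Require Import all_boot all_order all_algebra.
From mathcomp Require Import all_classical all_reals all_analysis.

Set Implicit Arguments.
Unset Strict Implicit.
Unset Printing Implicit Defensive.

Import Order.TTheory GRing.Theory Num.Theory.
Import numFieldNormedType.Exports.

Local Open Scope classical_set_scope.
Local Open Scope ring_scope.

#[short(type="finNormedModType")]
HB.structure Definition FinDimNormedModule (K : numFieldType) :=
  {V of NormedModule K V & Vector K V}.

(* The second exterior power is realized inside the tensor square, with        *)
(* V (x) V identified with Hom(V^*, V) by v (x) w = (phi |-> phi(v) w), and    *)
(* v /\ w = v (x) w - w (x) v.  In characteristic 0 this is the exterior       *)
(* square up to a unique isomorphism: see ext2_universal and ext2_unique.      *)
Section ExteriorSquare.
Context {K : numFieldType} {V : vectType K}.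

Definition wedge_fun (v w : V) (phi : 'Hom(V, K^o)) : V :=
  (phi v : K) *: w - (phi w : K) *: v.

Definition wedge_tensor (v w : V) : 'Hom('Hom(V, K^o), V) :=
  linfun (wedge_fun v w).

Fact wedge_fun_linear v w : linear (wedge_fun v w).
Proof.
move=> a p q; rewrite /wedge_fun !add_lfunE !scale_lfunE /=.
by rewrite !scalerDl scalerBr !scalerA opprD addrACA.
Qed.

HB.instance Definition _ v w :=
  GRing.isLinear.Build K _ V _ (wedge_fun v w) (wedge_fun_linear v w).

Lemma wedge_tensorE v w phi :
  wedge_tensor v w phi = (phi v : K) *: w - (phi w : K) *: v.
Proof. by rewrite lfunE. Qed.

Definition ext2_space : {vspace 'Hom('Hom(V, K^o), V)} :=
  <<[seq wedge_tensor u v | u <- vbasis fullv, v <- vbasis fullv]>>%VS.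

End ExteriorSquare.

Section Ext2.
Context {K : numFieldType} {V : vectType K}.

Lemma wedge_tensor_linear (v : V) : linear (wedge_tensor v).
Proof.
move=> a x y; apply/lfunP => phi.
rewrite add_lfunE scale_lfunE !wedge_tensorE.
have -> : (phi (a *: x + y) : K) = a * phi x + phi y by rewrite linearP.
rewrite scalerDr scalerDl scalerBr !scalerA [phi v * a]mulrC opprD.
by rewrite addrACA.
Qed.

Lemma wedge_tensorC (v w : V) : wedge_tensor v w = - wedge_tensor w v.
Proof. by apply/lfunP => phi; rewrite opp_lfunE !wedge_tensorE opprB. Qed.

Lemma wedge_tensor_in (v w : V) : wedge_tensor v w \in @ext2_space K V.
Proof.
have sumr u I (r : seq I) (c : I -> K) (x : I -> V) :
    wedge_tensor u (\sum_(i <- r) c i *: x i) =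
    \sum_(i <- r) c i *: wedge_tensor u (x i).
  elim: r => [|j r IH].
    have := wedge_tensor_linear u (-1) 0 0.
    by rewrite !big_nil scaler0 addr0 scaleN1r addNr.
  by rewrite !big_cons wedge_tensor_linear IH.
pose e := vbasis (@fullv K V).
have Ee u : u = \sum_(i < _) coord e i u *: e`_i.
  by apply: coord_vbasis; rewrite memvf.
rewrite (Ee w) sumr rpred_sum// => i _; rewrite rpredZ//.
rewrite wedge_tensorC rpredN (Ee v) sumr rpred_sum// => j _; rewrite rpredZ//.
apply: memv_span; apply/allpairsP; exists (e`_i, e`_j).
by rewrite !mem_nth ?size_tuple.
Qed.

End Ext2.

Definition ext2 (K : numFieldType) (V : vectType K) : vectType K :=
  subvs_of (@ext2_space K V).

Definition wedge (K : numFieldType) (V : vectType K) (v w : V) : ext2 V :=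
  Subvs (wedge_tensor_in v w).

Definition alternating_bilinear (K : numFieldType) (V U : lmodType K)
    (b : V -> V -> U) : Prop :=
  [/\ forall w, linear (b ^~ w), forall v, linear (b v) & forall v, b v v = 0].

Section Ext2Universal.
Context {K : numFieldType} {V : vectType K}.

Lemma wedge_alternating : alternating_bilinear (@wedge K V).
Proof.
have H v : linear (wedge v) by move=> a x y; apply/val_inj/wedge_tensor_linear.
have C (v w : V) : wedge v w = - wedge w v by apply/val_inj/wedge_tensorC.
split=> [w a x y|v|v]; [|exact: H|].
  by rewrite /= ![wedge _ w]C H opprD scalerN.
by apply/val_inj/lfunP => phi; rewrite /= wedge_tensorE subrr zero_lfunE.
Qed.

Lemma ext2_spanned (x : ext2 V) : exists (n : nat) (c : 'I_n -> K)
  (v w : 'I_n -> V), x = \sum_(i < n) c i *: wedge (v i) (w i).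
Proof.
pose e := vbasis (@fullv K V).
pose X := [seq wedge_tensor u v | u <- e, v <- e].
have xX : val x \in <<in_tuple X>>%VS := valP x.
have ex (i : 'I_(size X)) : exists p : V * V, X`_i = wedge_tensor p.1 p.2.
  by have /allpairsP[[u v] [_ _ /= ->]] := mem_nth 0 (ltn_ord i); exists (u, v).
have [f Hf] := choice ex.
exists (size X), (fun i => coord (in_tuple X) i (val x)),
  (fun i => (f i).1), (fun i => (f i).2).
apply: val_inj; rewrite {1}(coord_span xX) [RHS](linear_sum vsval).
by apply: eq_bigr => i _; rewrite [RHS](linearZZ vsval) /= -Hf.
Qed.

Theorem ext2_unique (U : lmodType K) (g h : {linear ext2 V -> U}) :
  (forall v w, g (wedge v w) = h (wedge v w)) -> g =1 h.
Proof.
move=> gh x; have [n [c [v [w ->]]]] := ext2_spanned x.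
by rewrite !linear_sum; apply: eq_bigr => i _; rewrite !linearZZ gh.
Qed.

Theorem ext2_universal (U : lmodType K) (b : V -> V -> U) :
  alternating_bilinear b ->
  exists g : {linear ext2 V -> U}, forall v w, g (wedge v w) = b v w.
Proof.
case=> bl br b0.
pose e := vbasis (@fullv K V).
pose d i : 'Hom(V, K^o) := linfun (coord e i).
pose g (x : ext2 V) : U := 2^-1 *: \sum_(i < _) b e`_i (val x (d i)).
have gL : linear g.
  move=> a x y; rewrite /g scalerA mulrC -scalerA -scalerDr; congr (_ *: _).
  rewrite scaler_sumr -big_split /=; apply: eq_bigr => i _.
  by rewrite add_lfunE scale_lfunE br.
pose gm := GRing.isLinear.Build K (ext2 V) U _ g gL.
pose G : {linear ext2 V -> U} := HB.pack g gm.
exists G => v w.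
have bC x y : b x y = - b y x.
  apply/eqP; rewrite -addr_eq0; apply/eqP.
  have := b0 (x + y).
  have lD z x1 y1 : b (x1 + y1) z = b x1 z + b y1 z.
    by have := bl z 1 x1 y1; rewrite !scale1r.
  have rD z x1 y1 : b z (x1 + y1) = b z x1 + b z y1.
    by have := br z 1 x1 y1; rewrite !scale1r.
  by rewrite lD !rD !b0 add0r addr0.
have E x y : \sum_(i < _) coord e i x *: b e`_i y = b x y.
  have b0y : b 0 y = 0.
    by have := bl y (-1) 0 0; rewrite scaler0 addr0 scaleN1r addNr.
  have bs I (r : seq I) (c : I -> K) (z : I -> V) :
      b (\sum_(i <- r) c i *: z i) y = \sum_(i <- r) c i *: b (z i) y.
    by elim: r => [|j r IH]; rewrite ?big_nil// !big_cons bl IH.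
  by rewrite -bs -coord_vbasis ?memvf.
rewrite /G /= /g /=.
under eq_bigr => i _.
  rewrite wedge_tensorE !lfunE /= -scaleNr addrC br.
  have -> : b e`_i (coord e i v *: w) = coord e i v *: b e`_i w.
    have b00 : b e`_i 0 = 0.
      by have := br e`_i (-1) 0 0; rewrite scaler0 addr0 scaleN1r addNr.
    by have := br e`_i (coord e i v) w 0; rewrite !addr0 b00 addr0.
  over.
rewrite big_split /=.
under eq_bigr do rewrite scaleNr.
rewrite sumrN !E -bC -mulr2n -[b v w *+ 2]scaler_nat scalerA mulVf ?pnatr_eq0//.
by rewrite scale1r.
Qed.

End Ext2Universal.

Section BusemannHausdorff.
Context {R : realType} {V : finNormedModType R}.

Definition unit_ball : set V := [set v : V | `|v| <= 1].

Definition plane_map (v1 v2 : V) (p : R * R) : V := p.1 *: v1 + p.2 *: v2.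

Definition lebesgue_measure2 : set (R * R) -> \bar R :=
  (@lebesgue_measure R \x @lebesgue_measure R)%E.

(* The area density at the simple 2-vector v1 /\ v2.  In \bar R, pi / +oo = 0, *)
(* which is the value for linearly dependent v1, v2.                           *)
Definition bh_area (v1 v2 : V) : \bar R :=
  ((@pi R)%:E / lebesgue_measure2 (plane_map v1 v2 @^-1` unit_ball))%E.

End BusemannHausdorff.

(* Main.v *)
(** For functionals [f_1, ..., f_n] in the dual unit ball and weights [p] in the
    simplex, [s |-> pi/2 * \sum_ij p_i p_j |(f_i /\ f_j)(s)|] is a seminorm on
    [ext2 V]; the extension is the supremum of all of these (Burago-Ivanov).

    On the plane spanned by [v1, v2] the [f_i] become vectors [y_i] of [R * R], and
    [(f_i /\ f_j)(v1 /\ v2)] becomes [cross y_i y_j].  Let [p] maximize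
    [l = \sum_ij p_i p_j |cross y_i y_j|].  The first-order condition says that
    [z |-> l^-1 * \sum_j p_j |cross z y_j|], the support function of a zonogon, is at
    most 1 at every [y_i], with equality when [p_i > 0].  Since this function is
    linear between consecutive [+-y_i] with [p_i > 0], the zonogon is exactly the
    polygon [{x | forall i, |dot y_i x| <= 1}]; summing cross products of its
    generators gives the area [2 / l].  This polygon contains the section [K] of the
    unit ball, so [pi / 2 * l <= pi / mu K]; and by Hahn-Banach, [K] is a decreasing
    intersection of such polygons, so the bound is attained in the limit. *)

From HB Require Import structures.
Require Import Defs.
From mathcomp Require Import all_boot all_order all_algebra.
From mathcomp Require Import all_classical all_reals all_analysis.
From mathcomp Require Import measurable_realfun ring lra.
Import Order.TTheory GRing.Theory Num.Theory.
Import numFieldNormedType.Exports.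
Local Open Scope classical_set_scope.
Local Open Scope ring_scope.

Set Implicit Arguments.
Unset Strict Implicit.
Unset Printing Implicit Defensive.

(** * Sublinear functionals and the finite-dimensional Hahn-Banach theorem *)

Section HahnBanach.
Context {R : realType}.

Definition sublinear (V : lmodType R) (q : V -> R) :=
  (forall x y, q (x + y) <= q x + q y) /\
  (forall (a : R) x, 0 <= a -> q (a *: x) <= a * q x).

Section Sublinear.
Context {V : lmodType R} {q : V -> R} (qS : sublinear q).

Lemma sublinear0 : q 0 = 0.
Proof.
have [qD qZ] := qS; apply/eqP; rewrite eq_le.
have := qD 0 0; have := qZ 0 0 (lexx _); rewrite addr0 scaler0 mul0r.
by move=> -> /=; lra.
Qed.

Lemma sublinearZ a x : 0 <= a -> q (a *: x) = a * q x.
Proof.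
have [qD qZ] := qS; rewrite le_eqVlt => /predU1P[<-|a0].
  by rewrite scale0r mul0r sublinear0.
apply/eqP; rewrite eq_le qZ ?(ltW a0)//=.
rewrite -ler_pdivlMl//.
by rewrite -{1}[x](scalerK (lt0r_neq0 a0)) qZ// invr_ge0 ltW.
Qed.

Lemma sublinearN x : - q (- x) <= q x.
Proof. by have := qS.1 x (- x); rewrite subrr sublinear0; lra. Qed.

(** The classical lowering of [q]: a sublinear minorant that is linear on the line through [z]. *)
Definition drop_along (z x : V) : R :=
  inf [set q (x + t *: z) - t * q z | t in [set t | 0 <= t]].

Let lb z x (t : R) : 0 <= t -> - q (- x) <= q (x + t *: z) - t * q z.
Proof.
move=> t0; rewrite -sublinearZ//.
have := qS.1 (x + t *: z) (- x); rewrite addrC addKr; lra.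
Qed.

Lemma drop_alongP z x (t : R) : 0 <= t -> drop_along z x <= q (x + t *: z) - t * q z.
Proof.
move=> t0; apply: ge_inf; last by exists t.
by exists (- q (- x)) => _ [s s0 <-]; exact: lb.
Qed.

Lemma le_drop_along z x b :
  (forall t, 0 <= t -> b <= q (x + t *: z) - t * q z) -> b <= drop_along z x.
Proof.
move=> H; apply: lb_le_inf; first by exists (q (x + 0 *: z) - 0 * q z), 0 => /=.
by move=> _ [t t0 <-]; exact: H.
Qed.

Lemma drop_along_le z x : drop_along z x <= q x.
Proof. by have := drop_alongP z x (lexx 0); rewrite scale0r addr0 mul0r subr0. Qed.

Lemma drop_alongN z : drop_along z (- z) <= - q z.
Proof.
have := drop_alongP z (- z) ler01.
by rewrite scale1r addNr sublinear0 mul1r sub0r.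
Qed.

Lemma drop_along_sublinear z : sublinear (drop_along z).
Proof.
split=> [x y|a x].
  rewrite -lerBlDr; apply: le_drop_along => t t0.
  (* Parameters [t] for [x] and [s] for [y] combine into the parameter [t + s] for [x + y]. *)
  rewrite lerBlDr -lerBlDl; apply: le_drop_along => s s0.
  rewrite lerBlDl (le_trans (drop_alongP z _ (addr_ge0 t0 s0)))//.
  have := qS.1 (x + t *: z) (y + s *: z).
  by rewrite addrACA -scalerDl; lra.
rewrite le_eqVlt => /predU1P[<-|a0].
  by rewrite scale0r mul0r (le_trans (drop_along_le _ _))// sublinear0.
rewrite mulrC -ler_pdivrMr//; apply: le_drop_along => t t0.
rewrite ler_pdivrMr// (le_trans (drop_alongP z _ (mulr_ge0 (ltW a0) t0)))//.
rewrite -scalerA -scalerDr sublinearZ ?(ltW a0)//; lra.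
Qed.

End Sublinear.

(** Lower [q] along the vectors of [s] one after another. Oddness at [z] survives the later
    lowerings: [q' (- z) <= - q z <= - q' z]. *)
Lemma sublinear_odd_below (V : lmodType R) (s : seq V) (q : V -> R) :
  sublinear q -> exists q', [/\ sublinear q', forall x, q' x <= q x &
    forall z, z \in s -> q' (- z) <= - q' z].
Proof.
elim: s q => [|z s IH] q qS; first by exists q.
have [q' [q'S q'q q's]] := IH _ (drop_along_sublinear qS z).
exists q'; split=> // [x|u]; first exact: le_trans (q'q x) (drop_along_le qS z x).
rewrite inE => /predU1P[->|/q's//].
apply: le_trans (q'q _) _; apply: le_trans (drop_alongN qS z) _.
by rewrite lerN2; apply: le_trans (q'q z) (drop_along_le qS z z).
Qed.

(** Lower [q] along [x0], then along a basis. A sublinear functional that is odd on a basis is odd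
    everywhere, hence linear; the lowering along [x0] forces the value [q x0] there. *)
Lemma hahn_banach (V : vectType R) (q : V -> R) (x0 : V) : sublinear q ->
  exists f : 'Hom(V, R^o), (forall x, f x <= q x) /\ f x0 = q x0.
Proof.
move=> qS; pose e := vbasis (@fullv R V).
have [q' [q'S q'q q'e]] := sublinear_odd_below e (drop_along_sublinear qS x0).
have odd_eq x : (q' (- x) <= - q' x) -> q' (- x) = - q' x.
  by move=> H; apply/eqP; rewrite eq_le H/=; have := sublinearN q'S x; lra.
have q'N x : q' (- x) = - q' x.
  apply: (odd_eq x); have xE : x = \sum_i coord e i x *: e`_i.
    by apply: coord_vbasis; rewrite memvf.
  rewrite xE; elim/big_ind: _ => [|u v Hu Hv|i _].
  - by rewrite oppr0 (sublinear0 q'S) oppr0.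
  - rewrite opprD; have := q'S.1 u v; have := q'S.1 (- u) (- v); lra.
  - have ei : q' (- e`_i) = - q' e`_i by apply/odd_eq/q'e; rewrite mem_nth ?size_tuple.
    have [a0|a0] := leP 0 (coord e i x).
      by rewrite -scalerN !(sublinearZ q'S)// ei mulrN.
    rewrite -scaleNr (sublinearZ q'S) ?oppr_ge0 ?(ltW a0)//.
    rewrite -[in leRHS](opprK (coord e i x)) scaleNr -scalerN.
    rewrite (sublinearZ q'S) ?oppr_ge0 ?(ltW a0)//.
    by rewrite ei; lra.
have q'D x y : q' (x + y) = q' x + q' y.
  apply/eqP; rewrite eq_le q'S.1/=.
  have := q'S.1 (x + y) (- y); rewrite addrK q'N; lra.
have q'L : linear (q' : V -> R^o).
  move=> a x y; rewrite q'D; congr (_ + _).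
  have [a0|a0] := leP 0 a; first by rewrite (sublinearZ q'S).
  apply: oppr_inj; rewrite -q'N -scaleNr (sublinearZ q'S) ?oppr_ge0 ?(ltW a0)//.
  by rewrite mulNr.
pose gm := GRing.isLinear.Build R V R^o _ q' q'L.
pose g : {linear V -> R^o} := HB.pack (q' : V -> R^o) gm.
exists (linfun g); split=> [x|].
  by rewrite lfunE; exact: le_trans (q'q x) (drop_along_le qS x0 x).
rewrite lfunE /=; apply/eqP; rewrite eq_le.
rewrite (le_trans (q'q x0) (drop_along_le qS x0 x0))/=.
have := le_trans (q'q (- x0)) (drop_alongN qS x0).
by rewrite q'N lerN2.
Qed.

End HahnBanach.

(** Each [y] with [g y > 0] bounds [t] from below and each [y] with [g y < 0] bounds it from above.
    These bounds are compatible, so the supremum of the lower ones serves as [t]; the point [-1] of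
    [A] ensures [t >= -1]. *)
Lemma sublinear_split (R : realType) (E : lmodType R) (h f g : E -> R) : sublinear h ->
  (forall a x y, f (a *: x + y) = a * f x + f y) ->
  (forall a x y, g (a *: x + y) = a * g x + g y) ->
  (forall y, f y <= h y + `|g y|) ->
  exists t, `|t| <= 1 /\ forall y, f y <= h y + t * g y.
Proof.
move=> hS fL gL fhg.
pose A : set R := [set -1] `|` [set (f y - h y) / g y | y in [set y | 0 < g y]].
have fZ a x y b : f (a *: x + b *: y) = a * f x + b * f y.
  have f0 : f 0 = 0 by have := fL (-1) 0 0; rewrite scaler0 addr0; lra.
  by rewrite fL -[b *: y]addr0 fL f0 addr0.
have gZ a x y b : g (a *: x + b *: y) = a * g x + b * g y.
  have g0 : g 0 = 0 by have := gL (-1) 0 0; rewrite scaler0 addr0; lra.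
  by rewrite gL -[b *: y]addr0 gL g0 addr0.
have A1 : ubound A 1.
  move=> _ [->|[y /= y0 <-]]; first lra.
  by rewrite ler_pdivrMr// mul1r; have := fhg y; rewrite gtr0_norm//; lra.
have AN y : g y < 0 -> ubound A ((h y - f y) / - g y).
  move=> y0 _ [->|[z /= z0 <-]].
    rewrite ler_pdivlMr ?oppr_gt0//; have := fhg y; rewrite ltr0_norm//; lra.
  rewrite ler_pdivrMr// mulrAC ler_pdivlMr ?oppr_gt0//.
  (* This combination is chosen to annihilate [g]. *)
  have := fhg (g z *: y + - g y *: z).
  rewrite fZ gZ (_ : _ + - g y * g z = 0) ?normr0 ?addr0; last by ring.
  have yN : 0 <= - g y by lra.
  have := hS.1 (g z *: y) (- g y *: z).
  rewrite !(sublinearZ hS) ?(ltW z0)//; lra.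
have A0 : A (-1) by left.
have sA : has_sup A by split; [exists (-1)|exists 1].
exists (sup A); split=> [|y].
  rewrite ler_norml; apply/andP; split; first by apply: ub_le_sup A0; exists 1.
  by apply: ge_sup A1; exists (-1).
have [y0|y0|y0] := ltrgt0P (g y).
- have : (f y - h y) / g y <= sup A.
    by apply: ub_le_sup; [exists 1|right; exists y].
  by rewrite ler_pdivrMr//; lra.
- have : sup A <= (h y - f y) / - g y by apply: ge_sup (AN _ y0); exists (-1).
  by rewrite ler_pdivlMr ?oppr_gt0//; lra.
- by have := fhg y; rewrite y0 normr0 mulr0.
Qed.

(** * Zonogons and their vertical slices *)

Section Zonogon.
Context {R : realType}.
Implicit Types (x y u v w : R * R) (ws : seq (R * R)).

Definition dot y x : R := y.1 * x.1 + y.2 * x.2.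

Definition cross y x : R := y.1 * x.2 - y.2 * x.1.

(** The Minkowski sum of the segments from [- w] to [w], encoded by its support function;
    [zonogon_cons] recovers the sum. *)
Definition zonogon ws : set (R * R) :=
  [set x | forall y, dot y x <= \sum_(w <- ws) `|dot y w|].

Lemma dotDZ (a : R) (x y z : (R^o * R^o)%type) :
  dot (a *: x + y) z = a * dot x z + dot y z.
Proof. by rewrite /dot/= /GRing.scale/=; ring. Qed.

Lemma support_sublinear ws :
  sublinear (fun y : (R^o * R^o)%type => \sum_(w <- ws) `|dot y w|).
Proof.
split=> [x y|a x a0].
  rewrite -big_split/=; apply: ler_sum => w _.
  by rewrite -[x]scale1r dotDZ mul1r scale1r ler_normD.
rewrite mulr_sumr; apply: ler_sum => w _.
have -> : dot (a *: x) w = a * dot x w by rewrite /dot/= /GRing.scale/=; ring.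
by rewrite normrM ger0_norm.
Qed.

Lemma zonogon_cons w ws x : zonogon (w :: ws) x <->
  exists t, `|t| <= 1 /\ zonogon ws (x.1 - t * w.1, x.2 - t * w.2).
Proof.
split=> [xZ|[t [t1 xZ]] y].
  have [||y|t [t1 tP]] := sublinear_split (support_sublinear ws)
    (f := fun y => dot y x) (g := fun y => dot y w).
  - by move=> *; exact: dotDZ.
  - by move=> *; exact: dotDZ.
  - by have := xZ y; rewrite big_cons addrC.
  - by exists t; split=> // y; have := tP y; rewrite /dot/=; lra.
rewrite big_cons; have := xZ y.
have -> : dot y (x.1 - t * w.1, x.2 - t * w.2) = dot y x - t * dot y w.
  by rewrite /dot/=; ring.
have : t * dot y w <= `|dot y w|.
  by rewrite (le_trans (ler_norm _))// normrM ler_piMl.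
lra.
Qed.

(** The projection of a Minkowski sum is the sum of the projected segments. *)
Lemma zonogon_fst ws (a : R) :
  (exists b, zonogon ws (a, b)) <-> `|a| <= \sum_(w <- ws) `|w.1|.
Proof.
split=> [[b ab]|].
  have dotl c w : dot (c, 0) w = c * w.1 by rewrite /dot/=; lra.
  have H c : c * a <= `|c| * \sum_(w <- ws) `|w.1|.
    have := ab (c, 0); rewrite dotl mulr_sumr.
    by under eq_bigr do rewrite dotl normrM.
  by have := H 1; have := H (-1); rewrite normrN1 normr1 ler_norml; lra.
elim: ws a => [|w ws IH] a.
  rewrite big_nil normr_le0 => /eqP ->; exists 0 => y.
  by rewrite big_nil /dot/=; lra.
rewrite big_cons; set A := (X in _ + X) => aA.
have A0 : 0 <= A by exact: sumr_ge0.
have [t [t1 tA]] : exists t, `|t| <= 1 /\ `|a - t * w.1| <= A.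
  have [aA'|aA'] := leP `|a| A.
    by exists 0; rewrite normr0 ler01 mul0r subr0.
  have w0 : 0 < `|w.1| by lra.
  have a0 : 0 < `|a| by lra.
  have w0' : w.1 != 0 by rewrite -normr_gt0.
  (* With this [t], [a - t * w.1] is [A * a / |a|], the point of absolute value [A] on the side of
     [a]. *)
  exists ((1 - A / `|a|) * a / w.1); split.
    rewrite normrM normfV ler_pdivrMr// normrM mul1r ger0_norm.
      by rewrite mulrBl mul1r divfK ?gt_eqF//; lra.
    by rewrite subr_ge0 ler_pdivrMr// mul1r ltW.
  rewrite divfK// mulrBl mul1r opprB addrC subrK normrM ger0_norm ?divr_ge0//.
  by rewrite divfK// gt_eqF.
have [b bP] := IH _ tA.
by exists (b + t * w.2); apply/zonogon_cons; exists t; rewrite /= addrK.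
Qed.

Definition slice ws (a : R) : set R := [set b | zonogon ws (a, b)].

(** Each constraint [y] bounds [b] above, below or not at all, according to the sign of [y.2]. Such
    bounds pass to the supremum and the infimum, so both end points belong to the slice. *)
Lemma slice_itv ws (a : R) : `|a| <= \sum_(w <- ws) `|w.1| ->
  exists l u : R, l <= u /\ slice ws a = `[l, u]%classic.
Proof.
move=> /zonogon_fst[b0 sb0].
pose h y := \sum_(w <- ws) `|dot y w|.
have ubS : ubound (slice ws a) (h (0, 1)).
  by move=> b /(_ (0, 1)); rewrite /dot/= /h mul0r mul1r add0r; apply.
have lbS : lbound (slice ws a) (- h (0, -1)).
  move=> b /(_ (0, -1)); rewrite /h {1}/dot/= mul0r mulN1r add0r.
  by rewrite lerNl.
have S0 : slice ws a !=set0 by exists b0.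
have uS b : slice ws a b -> b <= sup (slice ws a).
  by move=> bS; apply: ub_le_sup => //; exists (h (0, 1)).
have lS b : slice ws a b -> inf (slice ws a) <= b.
  by move=> bS; apply: ge_inf => //; exists (- h (0, -1)).
exists (inf (slice ws a)), (sup (slice ws a)).
split; first exact: le_trans (lS _ sb0) (uS _ sb0).
apply/seteqP; split=> [b bS|b /=]; first by rewrite /= in_itv/= lS ?uS.
rewrite in_itv/= => /andP[lb bu] y; rewrite /dot/= -lerBrDl.
have [y0|y0|y0] := ltrgt0P y.2.
- rewrite mulrC -ler_pdivlMr//; apply: le_trans bu _.
  apply: ge_sup => // c cS; rewrite ler_pdivlMr// mulrC.
  by have := cS y; rewrite /dot/=; lra.
- rewrite mulrC -ler_ndivrMr//; apply: le_trans _ lb.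
  apply: lb_le_inf => // c cS; rewrite ler_ndivrMr// mulrC.
  by have := cS y; rewrite /dot/=; lra.
- by have := sb0 y; rewrite /dot/= y0; lra.
Qed.

Lemma slice_cons (c : R) ws (a l u : R) : l <= u -> slice ws a = `[l, u]%classic ->
  slice ((0, c) :: ws) a = `[l - `|c|, u + `|c|]%classic.
Proof.
move=> lu sE; have memE b : zonogon ws (a, b) <-> l <= b <= u.
  by rewrite -[zonogon _ _]/(slice ws a b) sE /= in_itv.
apply/seteqP; split=> [b /zonogon_cons[t [t1 /=]]|b /=].
  rewrite mulr0 subr0 => /memE /andP[lb bu]; rewrite /= in_itv/=.
  have : `|t * c| <= `|c| by rewrite normrM ler_piMl.
  by rewrite ler_norml => /andP[? ?]; apply/andP; split; lra.
rewrite in_itv/= => /andP[lb bu]; apply/zonogon_cons => /=.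
have [c0|c0] := eqVneq c 0.
  exists 0; rewrite normr0 ler01 !mul0r !subr0; split=> //; apply/memE.
  by move: lb bu; rewrite c0 normr0 addr0 subr0 => -> ->.
(* [d] is the point of the old slice nearest to [b]. *)
pose d := Num.max l (Num.min b u).
have [ld du dl dr] : [/\ l <= d, d <= u, b - d <= `|c| & d - b <= `|c|].
  have := normr_ge0 c; rewrite /d /Num.max /Num.min.
  by do 2?case: ifPn; rewrite -?leNgt => *; split; lra.
exists ((b - d) / c); split.
  rewrite normrM normfV ler_pdivrMr ?normr_gt0// mul1r ler_norml dl andbT; lra.
by rewrite mulr0 subr0 divfK//; apply/memE; rewrite opprB addrC subrK ld du.
Qed.

Lemma slice0 ws (a : R) : ~~ (`|a| <= \sum_(w <- ws) `|w.1|) ->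
  slice ws a = set0.
Proof.
move=> aA; rewrite -subset0 => b ab; case/negP: aA; apply/zonogon_fst.
by exists b.
Qed.

End Zonogon.

(** * Shear invariance of plane measure, rational points, measurability of zonogons *)

Section PlaneMeasure.
Context {R : realType}.
Local Notation mu := (@lebesgue_measure R).
Local Notation mu2 := (@lebesgue_measure2 R).

(** The pushforward under translation agrees with Lebesgue measure on half-open intervals, so
    uniqueness applies. *)
Lemma lebesgue_measure_translate (c : R) (A : set R) : measurable A ->
  mu ((fun x => x + c) @^-1` A) = mu A.
Proof.
pose f (x : measurableTypeR R) : measurableTypeR R := x + c.
have mf : measurable_fun setT f by exact: measurable_funD.
have itvE X : ocitv X -> mu X = pushforward mu f X.
  move=> [[a b] _ <-] /=; rewrite /pushforward.
  have -> : f @^-1` `]a, b] = `](a - c), (b - c)]%classic.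
    by apply/seteqP; split=> x /=; rewrite !in_itv/= ltrBlDr lerBrDr.
  rewrite !lebesgue_measure_itv /= !lte_fin ltrD2r; case: ifP => // _.
  by rewrite -!EFinB opprB addrA subrK.
move=> mA; rewrite -[LHS]/(pushforward mu f A); apply/esym.
pose m' := measure_function_pushforward__canonical__measure_function_Measure mu mf.
exact: (@lebesgue_measure_unique _ m').
Qed.

Definition shear2 (c : R) (x : R * R) : R * R := (x.1, x.2 + c * x.1).

Definition shear1 (c : R) (x : R * R) : R * R := (x.1 + c * x.2, x.2).

Lemma measurable_shear1 c : measurable_fun setT (shear1 c).
Proof.
apply: measurable_fun_pair => //.
by apply: measurable_funD => //; exact: measurable_funM.
Qed.

Lemma mu2_ysection (A : set (R * R)) : measurable A ->
  mu2 A = (\int[mu]_y mu (ysection A y))%E.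
Proof.
move=> mA; rewrite /lebesgue_measure2.
rewrite (product_measure_unique (m' := (mu \x^ mu)%E))//.
by move=> X Y mX mY; exact: product_measure2E.
Qed.

(** Cavalieri: the shear translates each vertical section. *)
Lemma mu2_shear2 c (A : set (R * R)) : measurable A ->
  mu2 (shear2 c @^-1` A) = mu2 A.
Proof.
move=> mA; apply: eq_integral => a _ /=.
rewrite -(lebesgue_measure_translate (c * a) (measurable_xsection _ mA)).
by congr (mu _); apply/seteqP; split=> b; rewrite /xsection/= !inE.
Qed.

Lemma mu2_shear1 c (A : set (R * R)) : measurable A ->
  mu2 (shear1 c @^-1` A) = mu2 A.
Proof.
move=> mA; rewrite !mu2_ysection//; last first.
  by rewrite -[X in measurable X]setTI; exact: measurable_shear1.
apply: eq_integral => b _ /=.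
rewrite -(lebesgue_measure_translate (c * b) (measurable_ysection _ mA)).
by congr (mu _); apply/seteqP; split=> a; rewrite /ysection/= !inE.
Qed.

Definition rat_point (n : nat) : R * R :=
  if (unpickle n : option (rat * rat)) is Some q then (ratr q.1, ratr q.2) else 0.

(** A sublinear functional is at most a constant times the sum of the absolute coordinates. Both
    differences are controlled because [N] may fail to be even. *)
Lemma rat_point_dense (N : (R^o * R^o)%type -> R) (x : (R^o * R^o)%type) e :
  sublinear N -> 0 < e ->
  exists n, N (rat_point n - x) < e /\ N (x - rat_point n) < e.
Proof.
move=> NS e0; have [ND NZ] := NS.
pose e1 : (R^o * R^o)%type := (1, 0); pose e2 : (R^o * R^o)%type := (0, 1).
pose M := 1 + `|N e1| + `|N (- e1)| + `|N e2| + `|N (- e2)|.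
have M0 : 0 < M.
  have := normr_ge0 (N e1); have := normr_ge0 (N (- e1)).
  by have := normr_ge0 (N e2); have := normr_ge0 (N (- e2)); rewrite /M; lra.
have axis (v : (R^o * R^o)%type) (a : R) : N v <= M -> N (- v) <= M ->
    N (a *: v) <= `|a| * M.
  move=> v1 v2; have [a0|a0] := leP 0 a.
    by rewrite (sublinearZ NS)// ger0_norm// ler_wpM2l.
  have aN : 0 <= - a by lra.
  have -> : a *: v = (- a) *: (- v) by rewrite scalerN scaleNr opprK.
  by rewrite (sublinearZ NS)// ltr0_norm// ler_wpM2l.
have le1 : N e1 <= M /\ N (- e1) <= M.
  have := ler_norm (N e1); have := ler_norm (N (- e1)).
  have := normr_ge0 (N e1); have := normr_ge0 (N (- e1)).
  by have := normr_ge0 (N e2); have := normr_ge0 (N (- e2)); rewrite /M; lra.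
have le2 : N e2 <= M /\ N (- e2) <= M.
  have := ler_norm (N e2); have := ler_norm (N (- e2)).
  have := normr_ge0 (N e1); have := normr_ge0 (N (- e1)).
  by have := normr_ge0 (N e2); have := normr_ge0 (N (- e2)); rewrite /M; lra.
have NM (z : (R^o * R^o)%type) : N z <= (`|z.1| + `|z.2|) * M.
  have {1}-> : z = (z.1 : R) *: e1 + (z.2 : R) *: e2.
    rewrite /e1 /e2; case: z => z1 z2 /=.
    have -> : z1 *: ((1, 0) : (R^o * R^o)%type) + z2 *: ((0, 1) : (R^o * R^o)%type) =
        (z1 * 1 + z2 * 0, z1 * 0 + z2 * 1) by [].
    by rewrite !mulr0 !mulr1 addr0 add0r.
  apply: le_trans (ND _ _) _; rewrite mulrDl.
  by apply: lerD; [exact: (axis e1 z.1 le1.1 le1.2)|exact: (axis e2 z.2 le2.1 le2.2)].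
have d0 : 0 < e / M / 2 by rewrite !divr_gt0.
have [q1 q1P] : exists q, ratr q \in `]x.1, (x.1 + e / M / 2)[.
  by apply: rat_in_itvoo; rewrite ltrDl.
have [q2 q2P] : exists q, ratr q \in `]x.2, (x.2 + e / M / 2)[.
  by apply: rat_in_itvoo; rewrite ltrDl.
exists (pickle (q1, q2)); rewrite /rat_point pickleK /=.
move: q1P q2P; rewrite !in_itv/= => /andP[q1l q1u] /andP[q2l q2u].
have H (z : (R^o * R^o)%type) : `|z.1| < e / M / 2 -> `|z.2| < e / M / 2 -> N z < e.
  move=> z1 z2; apply: le_lt_trans (NM z) _; rewrite -ltr_pdivlMr//.
  lra.
by split; apply: H; rewrite /= ltr_norml; apply/andP; split; lra.
Qed.

Lemma measurable_halfplane (y : R * R) (h : R) :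
  measurable [set x : R * R | dot y x <= h].
Proof.
rewrite -[X in measurable X]setTI; apply: measurable_fun_le => //.
by apply: measurable_funD; exact: measurable_funM.
Qed.

(** The half-planes with rational normals already cut out the zonogon, which makes it a countable
    intersection. *)
Lemma measurable_zonogon (ws : seq (R * R)) : measurable (zonogon ws).
Proof.
pose h (y : R * R) := \sum_(w <- ws) `|dot y w|.
have -> : zonogon ws = \bigcap_n [set x | dot (rat_point n) x <= h (rat_point n)].
  apply/seteqP; split=> [x xZ n _|x xZ y]; first exact: xZ.
  (* Closeness in [N] controls both sides of the constraint, so one violated at [y] is also violated
     at a nearby rational normal. *)
  pose N (z : (R^o * R^o)%type) := h z + `|dot z x|.
  have NS : sublinear N.
    have := support_sublinear (x :: ws); rewrite (_ : (fun _ => _) = N)//.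
    by apply/funext => z; rewrite big_cons addrC.
  rewrite leNgt; apply/negP => hy.
  have d0 : 0 < dot y x - h y by rewrite subr_gt0.
  have [n [n1 n2]] := rat_point_dense y NS d0.
  have := xZ n I; rewrite /= leNgt => /negP; apply.
  pose z : R * R := rat_point n - y.
  have hD : h (rat_point n) <= h z + h y.
    by have := (support_sublinear ws).1 z y; rewrite subrK.
  have zx : dot (rat_point n) x = dot y x + dot z x by rewrite /dot/=; ring.
  have {}n1 : h z + `|dot z x| < dot y x - h y := n1.
  have := ler_norm (- dot z x); rewrite normrN.
  clearbody z h; lra.
by apply: bigcapT_measurable => n; exact: measurable_halfplane.
Qed.

End PlaneMeasure.

(** * The area of a zonogon *)

Section ZonogonArea.
Context {R : realType}.
Local Notation mu := (@lebesgue_measure R).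
Local Notation mu2 := (@lebesgue_measure2 R).
Implicit Types (w : R * R) (ws : seq (R * R)).

Lemma mu_slice_cons (c : R) ws (a : R) :
  mu (slice ((0, c) :: ws) a) = (mu (slice ws a) + (2 * `|c|)%:E *
    (\1_(`[- (\sum_(w <- ws) `|w.1|), \sum_(w <- ws) `|w.1|]%classic) a)%:E)%E.
Proof.
have [aA|aA] := boolP (`|a| <= \sum_(w <- ws) `|w.1|).
  have [l [u [lu sE]]] := slice_itv aA.
  rewrite (slice_cons _ lu sE) sE !lebesgue_measure_itv /= !lte_fin.
  rewrite indicE mem_set; last by rewrite /= in_itv/= -ler_norml.
  rewrite mule1; have c0 := normr_ge0 c.
  case: ltP => h1; case: ltP => h2; rewrite -?EFinB -?EFinD; congr EFin; lra.
rewrite !slice0//; last by rewrite big_cons normr0 add0r.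
rewrite measure0 indicE memNset ?mule0 ?adde0//=.
by rewrite in_itv/= -ler_norml; exact/negP.
Qed.

(** Every nonempty slice grows by [2 * |c|], over a projection of length twice the sum. *)
Lemma mu2_zonogon_vertical (c : R) ws : mu2 (zonogon ((0, c) :: ws)) =
  (mu2 (zonogon ws) + (4 * `|c| * \sum_(w <- ws) `|w.1|)%:E)%E.
Proof.
have E vs : mu2 (zonogon vs) = (\int[mu]_a mu (slice vs a))%E.
  by apply: eq_integral => a _ /=; congr (mu _);
    apply/seteqP; split=> b; rewrite /xsection/= inE.
rewrite !E; under eq_integral do rewrite mu_slice_cons.
set S := \sum_(w <- ws) _; have S0 : 0 <= S by exact: sumr_ge0.
have mS : measurable_fun setT (fun a => mu (slice ws a)).
  have := measurable_fun_xsection mu (measurable_zonogon ws).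
  congr (measurable_fun _ _); apply/funext => a /=; congr (mu _).
  by apply/seteqP; split=> b; rewrite /xsection/= inE.
have mI : measurable_fun setT (fun a : R => (\1_(`[- S, S]%classic) a)%:E : \bar R).
  by apply: measurableT_comp => //; exact: measurable_indic.
have c0 : (0 <= (2 * `|c|)%:E)%E by rewrite lee_fin mulr_ge0.
have I0 a : (0 <= (2 * `|c|)%:E * (\1_(`[- S, S]%classic) a)%:E)%E.
  by rewrite mule_ge0// lee_fin indicE.
rewrite ge0_integralD//; last exact: measurable_funeM.
rewrite ge0_integralZl_EFin ?mulr_ge0//.
rewrite integral_indic// setIT [X in ((2 * `|c|)%:E * X)%E]lebesgue_measure_itv /= lte_fin.
congr (_ + _)%E; case: ltP => h.
  by rewrite -EFinB -EFinM; congr EFin; ring.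
by rewrite (_ : S = 0) ?mulr0 ?mule0//; lra.
Qed.

(** [T'] is the adjoint of [T]; being onto, it lets every constraint on [x] be tested through a
    constraint on [T x], and conversely. *)
Lemma zonogon_image (T T' : R * R -> R * R) ws x :
  (forall y v, dot y (T v) = dot (T' y) v) -> (forall y, exists z, y = T' z) ->
  zonogon (map T ws) (T x) <-> zonogon ws x.
Proof.
move=> TT' T's; split=> xZ y.
  have [z ->] := T's y; rewrite -TT'; apply: le_trans (xZ z) _.
  by rewrite big_map; apply: ler_sum => w _; rewrite TT'.
rewrite TT'; apply: le_trans (xZ _) _.
by rewrite big_map; apply: ler_sum => w _; rewrite TT'.
Qed.

Lemma mu2_zonogon_shear1 c ws :
  mu2 (zonogon (map (shear1 c) ws)) = mu2 (zonogon ws).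
Proof.
rewrite -(mu2_shear1 c (measurable_zonogon _)); congr (mu2 _).
apply/seteqP; split=> x; apply zonogon_image with (T' := shear2 c).
- by move=> y v; rewrite /dot/shear1/shear2/=; ring.
- by move=> y; exists (shear2 (- c) y); case: y => y1 y2; rewrite /shear2/=; congr pair; ring.
- by move=> y v; rewrite /dot/shear1/shear2/=; ring.
- by move=> y; exists (shear2 (- c) y); case: y => y1 y2; rewrite /shear2/=; congr pair; ring.
Qed.

Lemma mu2_zonogon_shear2 c ws :
  mu2 (zonogon (map (shear2 c) ws)) = mu2 (zonogon ws).
Proof.
rewrite -(mu2_shear2 c (measurable_zonogon _)); congr (mu2 _).
apply/seteqP; split=> x; apply zonogon_image with (T' := shear1 c).
- by move=> y v; rewrite /dot/shear1/shear2/=; ring.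
- by move=> y; exists (shear1 (- c) y); case: y => y1 y2; rewrite /shear1/=; congr pair; ring.
- by move=> y v; rewrite /dot/shear1/shear2/=; ring.
- by move=> y; exists (shear1 (- c) y); case: y => y1 y2; rewrite /shear1/=; congr pair; ring.
Qed.

(** Shears preserve both area and [cross], so it suffices to shear [w] onto the vertical axis. *)
Lemma mu2_zonogon_cons w ws : mu2 (zonogon (w :: ws)) =
  (mu2 (zonogon ws) + (4 * \sum_(v <- ws) `|cross w v|)%:E)%E.
Proof.
have vert c vs : mu2 (zonogon ((0, c) :: vs)) =
    (mu2 (zonogon vs) + (4 * \sum_(v <- vs) `|cross (0, c) v|)%:E)%E.
  rewrite mu2_zonogon_vertical -mulrA mulr_sumr; congr (_ + (4 * _)%:E)%E.
  by apply: eq_bigr => v _; rewrite -normrM -normrN /cross/= mul0r sub0r.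
have gen u vs : u.2 != 0 -> mu2 (zonogon (u :: vs)) =
    (mu2 (zonogon vs) + (4 * \sum_(v <- vs) `|cross u v|)%:E)%E.
  move=> u0; pose c := - u.1 / u.2.
  rewrite -(mu2_zonogon_shear1 c) -(mu2_zonogon_shear1 c vs) /=.
  have -> : shear1 c u = (0, u.2) by rewrite /shear1 /c divfK// subrr.
  rewrite vert big_map; congr (_ + (4 * _)%:E)%E; apply: eq_bigr => v _.
  by congr `|_|; rewrite /cross/shear1/c/=; field.
have [w2|] := eqVneq w.2 0; last exact: gen.
have [w1|w1] := eqVneq w.1 0.
  by case: w w1 w2 => u1 u2 /= -> ->; exact: vert.
(* A nonzero horizontal [w] is first sheared to have second coordinate [w.1]. *)
rewrite -(mu2_zonogon_shear2 1) -(mu2_zonogon_shear2 1 ws) /= gen; last first.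
  by rewrite /shear2/= w2 add0r mul1r.
rewrite big_map; congr (_ + (4 * _)%:E)%E; apply: eq_bigr => v _.
by congr `|_|; rewrite /cross/shear2/=; ring.
Qed.

(** The double sum meets each unordered pair twice, which turns the factor 4 of [mu2_zonogon_cons]
    into 2. *)
Theorem mu2_zonogon ws : mu2 (zonogon ws) =
  (2 * \sum_(u <- ws) \sum_(v <- ws) `|cross u v|)%:E.
Proof.
elim: ws => [|w ws IH].
  rewrite big_nil mulr0; apply: integral0_eq => a _ /=.
  have [->|a0] := eqVneq a 0.
    apply/eqP; rewrite eq_le measure_ge0 andbT.
    rewrite (_ : xsection _ _ = [set 0]) ?lebesgue_measure_set1//.
    apply/seteqP; split=> b; rewrite /xsection/= inE /=.
      by move=> H; have := H (0, 1); have := H (0, -1); rewrite !big_nil /dot/=; lra.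
    by move=> -> y; rewrite big_nil /dot/=; lra.
  rewrite (_ : xsection _ _ = set0) ?measure0//.
  rewrite -subset0 => b; rewrite /xsection/= inE => /(_ (a, 0)).
  rewrite big_nil /dot/= mul0r addr0 -expr2 => H.
  by have := sqr_ge0 a; rewrite le_eqVlt ltNge H orbF eq_sym sqrf_eq0 (negPf a0).
rewrite mu2_zonogon_cons IH -EFinD !big_cons; congr EFin.
have -> : cross w w = 0 by rewrite /cross; ring.
rewrite normr0 add0r.
have -> : \sum_(u <- ws) \sum_(v <- w :: ws) `|cross u v| =
    \sum_(u <- ws) `|cross w u| + \sum_(u <- ws) \sum_(v <- ws) `|cross u v|.
  rewrite -big_split/=; apply: eq_bigr => u _; rewrite big_cons; congr (_ + _).
  by rewrite -normrN; congr `|_|; rewrite /cross; ring.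
ring.
Qed.

End ZonogonArea.

(** * Maximizing a quadratic form on the simplex *)

Section Simplex.
Context {R : realType} {n : nat}.
Implicit Types (p q : 'I_n -> R) (M : 'I_n -> 'I_n -> R).

Definition simplex p := (forall i, 0 <= p i) /\ \sum_i p i = 1.

Definition qform M p : R := \sum_i \sum_j p i * p j * M i j.

Lemma qform_max M : (0 < n)%N ->
  exists p, simplex p /\ forall q, simplex q -> qform M q <= qform M p.
Proof.
move=> n0; pose i0 := Ordinal n0.
pose S := [set v : 'rV[R]_n | forall i, `[0, 1]%classic (v ord0 i)].
pose T := [set v : 'rV[R]_n | \sum_i v ord0 i = 1].
have cS : compact S.
  apply: (@rV_compact R n (fun=> `[0, 1]%classic)) => _.
  exact: segment_compact.
have cT : closed T.
  have -> : T = (fun v : 'rV[R]_n => \sum_i v ord0 i) @^-1` [set 1] by [].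
  apply: closed_comp => [v _|]; last exact: closed_eq.
  apply: continuous_big => [|i _]; first exact: add_continuous.
  exact: coord_continuous.
have cST := compact_closedI cS cT.
have ST0 : S `&` T !=set0.
  exists (delta_mx ord0 i0); split=> [i|].
    by rewrite /= in_itv/= mxE eqxx/=; case: (i == i0); rewrite ler01 lexx.
  rewrite /T/= (bigD1 i0)//= mxE !eqxx big1 ?addr0// => i ii0.
  by rewrite mxE eqxx (negPf ii0).
have [|v] := EVT_max_rV (f := fun v => qform M (v ord0)) ST0 cST.
  apply: continuous_subspaceT.
  apply: continuous_big => [|i _]; first exact: add_continuous.
  apply: continuous_big => [|j _]; first exact: add_continuous.
  move=> v; apply: (@continuousM R _ (fun v : 'rV[R]_n => v ord0 i * v ord0 j)
    (fun=> M i j)); last exact: cst_continuous.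
  by apply: (@continuousM R _ (fun v : 'rV[R]_n => v ord0 i) (fun v => v ord0 j));
    exact: coord_continuous.
rewrite inE => -[vS vT] vmax; exists (v ord0); split; first split=> //.
  by move=> i; have := vS i; rewrite /= in_itv/= => /andP[].
move=> q [q0 q1]; have := vmax (\row_i q i).
have -> : (\row_i q i) ord0 = q by apply/funext => i; rewrite mxE.
apply; rewrite inE; split=> [i|]; last by rewrite /T/=; under eq_bigr do rewrite mxE.
rewrite /= in_itv/= mxE q0/= -q1 (bigD1 i)//= lerDl.
by apply: sumr_ge0 => j _.
Qed.

(** First-order condition: if row [i] exceeded the maximum, moving [p] towards the vertex [i] would
    increase the form. *)
Lemma qform_max_le M p : (forall i, M i i = 0) -> (forall i j, M i j = M j i) ->
  simplex p -> 0 <= qform M p -> (forall q, simplex q -> qform M q <= qform M p) ->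
  forall i, \sum_j p j * M i j <= qform M p.
Proof.
move=> M0 Msym [p0 p1] l0 pmax i; set l := qform M p; set m := \sum_j _.
rewrite leNgt; apply/negP => lm.
pose d := m - l; have d0 : 0 < d by rewrite subr_gt0.
have l0' : 0 <= l := l0.
(* The move changes the form by [t * (2 * d - t * (2 * d + l))]; this [t] makes the gain
   [t * d > 0]. *)
pose t := d / (2 * d + l); have dl0 : 0 < 2 * d + l by lra.
have t0 : 0 < t by rewrite divr_gt0.
have t1 : t <= 1 by rewrite ler_pdivrMr//; lra.
pose q j := (1 - t) * p j + t * (j == i)%:R.
have sumi (F : 'I_n -> R) : \sum_j (j == i)%:R * F j = F i.
  rewrite (bigD1 i)//= eqxx mul1r big1 ?addr0// => j /negPf ->.
  by rewrite mul0r.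
have qS : simplex q.
  split=> [j|]; first by rewrite /q addr_ge0// mulr_ge0// ?(ltW t0)//; lra.
  rewrite big_split/= -!mulr_sumr p1.
  by have := sumi (fun=> 1); under eq_bigr do rewrite mulr1; move=> ->; lra.
have qE : qform M q = (1 - t) ^+ 2 * l + 2 * (t * (1 - t)) * m.
  have -> : qform M q = \sum_k (q k * \sum_j q j * M k j).
    by apply: eq_bigr => k _; rewrite mulr_sumr; apply: eq_bigr => j _; rewrite mulrA.
  have rowE k : \sum_j q j * M k j = (1 - t) * (\sum_j p j * M k j) + t * M k i.
    rewrite -[M k i](sumi (M k)) !mulr_sumr -big_split/=; apply: eq_bigr => j _.
    by rewrite /q; ring.
  under eq_bigr do rewrite rowE.
  have -> : \sum_k q k * ((1 - t) * (\sum_j p j * M k j) + t * M k i) =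
      \sum_k ((1 - t) ^+ 2 * (p k * (\sum_j p j * M k j)) +
       (1 - t) * t * (p k * M i k)) +
      (\sum_k ((k == i)%:R * (t * (1 - t) * (\sum_j p j * M k j))) +
       \sum_k ((k == i)%:R * (t * t * M k i))).
    rewrite -!big_split/=; apply: eq_bigr => k _; rewrite /q (Msym i k); ring.
  rewrite !sumi M0 mulr0 addr0 big_split/= -!mulr_sumr.
  have -> : \sum_k p k * (\sum_j p j * M k j) = l.
    by apply: eq_bigr => k _; rewrite mulr_sumr; apply: eq_bigr => j _; rewrite mulrA.
  by rewrite -/m; ring.
have := pmax q qS; rewrite qE -/l.
have -> : m = d + l by rewrite /d subrK.
have tE : t * (2 * d + l) = d by rewrite divfK// gt_eqF.
have -> : (1 - t) ^+ 2 * l + 2 * (t * (1 - t)) * (d + l) =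
   l + t * (2 * d - t * (2 * d + l)) by ring.
rewrite tE; have : 0 < t * d by rewrite mulr_gt0.
lra.
Qed.

(** Complementary slackness: the row sums have [p]-average [qform M p] and none exceeds it. *)
Lemma qform_max_eq M p : (forall i, \sum_j p j * M i j <= qform M p) -> simplex p ->
  forall i, 0 < p i -> \sum_j p j * M i j = qform M p.
Proof.
move=> ple [p0 p1] i pi0; set l := qform M p.
have lE : l = \sum_k p k * \sum_j p j * M k j.
  by apply: eq_bigr => k _; rewrite mulr_sumr; apply: eq_bigr => j _; rewrite mulrA.
have d0 k : 0 <= p k * (l - \sum_j p j * M k j) by rewrite mulr_ge0// subr_ge0.
have : \sum_k p k * (l - \sum_j p j * M k j) = 0.
  under eq_bigr do rewrite mulrBr; rewrite sumrB -mulr_suml p1 mul1r -lE; lra.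
move=> /eqP; rewrite psumr_eq0// => /allP /(_ i (mem_index_enum _)) /=.
by rewrite mulf_eq0 (gt_eqF pi0)/= subr_eq0 => /eqP.
Qed.

End Simplex.

(** * The polar polygon of finitely many vectors as a zonogon *)

Section Polar.
Context {R : realType} {n : nat}.
Implicit Types (p : 'I_n -> R) (y : 'I_n -> R * R).
Local Notation mu2 := (@lebesgue_measure2 R).

Definition cross_mx y (i j : 'I_n) : R := `|cross (y i) (y j)|.

Definition polar y : set (R * R) := [set x | forall i, `|dot (y i) x| <= 1].

(** The vectors [y j], scaled and turned by a right angle so that [dot] with them becomes
    [cross]. *)
Definition rotated p y (c : R) : seq (R * R) :=
  [seq (p j / c * (y j).2, - (p j / c * (y j).1)) | j <- enum 'I_n].

Lemma support_rotated p y (c : R) z : (forall i, 0 <= p i) -> 0 < c ->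
  \sum_(w <- rotated p y c) `|dot z w| = (\sum_j p j * `|cross z (y j)|) / c.
Proof.
move=> p0 c0; rewrite big_map big_enum /= mulr_suml; apply: eq_bigr => j _.
have -> : dot z (p j / c * (y j).2, - (p j / c * (y j).1)) = (p j / c) * cross z (y j).
  by rewrite /dot/cross/=; ring.
by rewrite normrM ger0_norm ?divr_ge0 ?(ltW c0)// mulrAC.
Qed.

(** Rotation preserves [cross], and the scaling divides the double sum by the square of the form,
    leaving [2 * l / l ^ 2]. *)
Lemma mu2_rotated p y : (forall i, 0 <= p i) -> 0 < qform (cross_mx y) p ->
  mu2 (zonogon (rotated p y (qform (cross_mx y) p))) = (2 / qform (cross_mx y) p)%:E.
Proof.
move=> p0; set l := qform _ _ => l0; rewrite mu2_zonogon; congr (2 * _)%:E.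
rewrite big_map big_enum /=.
transitivity ((\sum_i \sum_j p i * p j * cross_mx y i j) / l / l); last first.
  by rewrite -/(qform _ _) -/l divff ?mul1r// gt_eqF.
rewrite !mulr_suml; apply: eq_bigr => i _; rewrite big_map big_enum !mulr_suml /=.
apply: eq_bigr => j _.
  have -> : cross (p i / l * (y i).2, - (p i / l * (y i).1))
      (p j / l * (y j).2, - (p j / l * (y j).1)) =
      (p i / l) * (p j / l) * cross (y i) (y j) by rewrite /cross/=; ring.
  have c0 k : 0 <= p k / l by rewrite divr_ge0// ltW.
  rewrite (normrM (_ * _)) (ger0_norm (mulr_ge0 (c0 i) (c0 j))) -/(cross_mx y i j).
  by field; rewrite gt_eqF.
Qed.

(* [z] lies between two consecutive directions [+-y i], between which
   [\sum_j p j * |cross _ (y j)|] is linear. *)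
Lemma polar_dot_le p y : simplex p -> 0 < qform (cross_mx y) p ->
  (forall i, 0 < p i -> \sum_j p j * cross_mx y i j = qform (cross_mx y) p) ->
  forall x z, polar y x -> qform (cross_mx y) p * dot z x <= \sum_j p j * `|cross z (y j)|.
Proof.
move=> [p0 p1]; set l := qform _ _ => l0 pl x z xP.
pose h z := \sum_j p j * `|cross z (y j)|; rewrite -/(h z).
have hZ c w : h (c * w.1, c * w.2) = `|c| * h w.
  rewrite /h mulr_sumr; apply: eq_bigr => j _.
  by rewrite (_ : cross _ _ = c * cross w (y j)) ?normrM /cross/=; ring.
have dZ c w : dot (c * w.1, c * w.2) x = c * dot w x by rewrite /dot/=; ring.
(* If [z] is parallel to some [y i] of positive weight, homogeneity reduces the claim to
   [z = y i]. *)
have [/existsP[i /andP[pi0 /eqP zi]]|nz] :=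
    boolP [exists i, (0 < p i) && (cross z (y i) == 0)].
  pose N := (y i).1 ^+ 2 + (y i).2 ^+ 2.
  have N0 : 0 < N.
    rewrite lt_neqAle addr_ge0 ?sqr_ge0// andbT eq_sym; apply/negP.
    rewrite paddr_eq0 ?sqr_ge0// !sqrf_eq0 => /andP[/eqP y1 /eqP y2].
    have := pl i pi0; rewrite big1; first by move=> l'; rewrite -l' ltxx in l0.
    by move=> j _; rewrite /cross_mx /cross y1 y2 !mul0r subrr normr0 mulr0.
  have zE : z = (dot z (y i) / N * (y i).1, dot z (y i) / N * (y i).2).
    rewrite [LHS]surjective_pairing; congr pair; apply: (mulIf (lt0r_neq0 N0)).
      rewrite mulrAC divfK ?gt_eqF//; apply/eqP; rewrite -subr_eq0; apply/eqP.
      transitivity ((y i).2 * cross z (y i)); last by rewrite zi mulr0.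
      by rewrite /cross /dot /N; ring.
    rewrite mulrAC divfK ?gt_eqF//; apply/eqP; rewrite -subr_eq0; apply/eqP.
    transitivity (- (y i).1 * cross z (y i)); last by rewrite zi mulr0.
    by rewrite /cross /dot /N; ring.
  rewrite zE hZ dZ -[h (y i)]/(\sum_j p j * cross_mx y i j) (pl i pi0) mulrC.
  rewrite ler_wpM2r ?(ltW l0)// (le_trans (ler_norm _))// normrM ler_piMr//.
have {}nz i : 0 < p i -> cross z (y i) != 0.
  by move=> pi0; apply: contra nz => zi; apply/existsP; exists i; rewrite pi0.
have [i0 pi0] : exists i, 0 < p i.
  apply/existsP; rewrite -[X in is_true X]negbK negb_exists; apply/negP => /forallP pn.
  have : \sum_i p i = 0.
    by apply: big1 => i _; apply/eqP; rewrite eq_le p0 andbT leNgt pn.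
  by rewrite p1 => /eqP; rewrite oner_eq0.
(* Signs move the weighted [y i] to the open half-plane counterclockwise from [z]; [s i] is then the
   cotangent of the angle from [z] to [u i]. *)
pose e i := Num.sg (cross z (y i)).
pose u i : R * R := (e i * (y i).1, e i * (y i).2).
pose c i := cross z (u i); pose s i := dot z (u i) / c i.
have c0 i : 0 < p i -> 0 < c i.
  move=> /nz zi; have -> : c i = e i * cross z (y i) by rewrite /c /cross /=; ring.
  by rewrite /e -normrEsg normr_gt0.
have e1 i : 0 < p i -> `|e i| = 1 by move=> /nz zi; rewrite normr_sg zi.
have N0 : 0 < z.1 ^+ 2 + z.2 ^+ 2.
  rewrite lt_neqAle addr_ge0 ?sqr_ge0// andbT eq_sym; apply/negP.
  rewrite paddr_eq0 ?sqr_ge0// !sqrf_eq0 => /andP[/eqP z1 /eqP z2].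
  by have := nz i0 pi0; rewrite /cross z1 z2 !mul0r subrr eqxx.
have us i j : 0 < p i -> 0 < p j ->
    (z.1 ^+ 2 + z.2 ^+ 2) * cross (u i) (u j) = c i * c j * (s i - s j).
  move=> /c0 ci /c0 cj; rewrite [in RHS]mulrBr.
  have -> : c i * c j * s i = dot z (u i) * c j by rewrite /s; field; rewrite gt_eqF.
  have -> : c i * c j * s j = dot z (u j) * c i by rewrite /s; field; rewrite gt_eqF.
  by rewrite /c /dot /cross; ring.
have ucr i j : 0 < p i -> 0 < p j -> s j <= s i -> 0 <= cross (u i) (u j).
  move=> pi pj sji; rewrite -(pmulr_rge0 _ N0) us//.
  by rewrite pmulr_rge0 ?subr_ge0// mulr_gt0 ?c0.
have cy w i : 0 < p i -> `|cross w (y i)| = `|cross w (u i)|.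
  move=> /e1 ei; rewrite -[LHS]mul1r -ei -normrM; congr `|_|.
  by rewrite /cross/u/=; ring.
have hu i : 0 < p i -> h (u i) = l.
  by move=> pi; rewrite /u hZ e1// mul1r -(pl i pi).
have dux i : 0 < p i -> `|dot (u i) x| <= 1.
  by move=> pi; rewrite /u dZ normrM e1// mul1r xP.
(* The cotangent decreases with the angle, so [u i] comes first and [u k] last, and [z] lies between
   [- u k] and [u i]. *)
have [i pi imax] := @arg_maxP _ _ _ i0 (fun i => 0 < p i) s pi0.
have [k pk kmin] := @arg_minP _ _ _ i0 (fun i => 0 < p i) s pi0.
pose D := cross (u i) (u k).
(* Otherwise all weighted vectors are parallel and [h (u i)] vanishes, whereas it equals [l > 0]. *)
have D0 : 0 < D.
  rewrite -(pmulr_rgt0 _ N0) us// pmulr_rgt0 ?mulr_gt0 ?c0// subr_gt0.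
  rewrite lt_neqAle [X in _ && X]imax// andbT.
  apply/negP => /eqP ski; have := hu i pi; rewrite /h big1.
    by move=> l'; rewrite -l' ltxx in l0.
  move=> j _; have [pj|pj] := ltP 0 (p j); last first.
    by rewrite (_ : p j = 0) ?mul0r//; apply/eqP; rewrite eq_le pj p0.
  rewrite cy//; have sij : s i = s j.
    by apply/eqP; rewrite eq_le [X in _ && X]imax// -ski kmin.
  rewrite (_ : cross _ _ = 0) ?normr0 ?mulr0//.
  by apply: (mulfI (lt0r_neq0 N0)); rewrite us// sij subrr !mulr0.
(* Since [D * z = c k * u i - c i * u k], this is the linearity of [h] on the cone of [u i] and
   [- u k]. *)
have hD : D * h z = c k * h (u i) + c i * h (u k).
  rewrite /h !mulr_sumr -big_split/=; apply: eq_bigr => j _.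
  have [pj|pj] := ltP 0 (p j); last first.
    by rewrite (_ : p j = 0) ?mul0r ?mulr0 ?addr0//; apply/eqP; rewrite eq_le pj p0.
  rewrite !cy// (gtr0_norm (c0 j pj)) (ger0_norm (ucr i j pi pj (imax j pj))).
  rewrite -normrN (_ : - cross (u k) (u j) = cross (u j) (u k)); last by rewrite /cross; ring.
  rewrite (ger0_norm (ucr j k pj pk (kmin j pj))).
  by rewrite /D /c /cross; ring.
rewrite -(ler_pM2l D0) hD !hu//.
have -> : D * (l * dot z x) = l * (c k * dot (u i) x - c i * dot (u k) x).
  by rewrite /D /c /cross /dot; ring.
have -> : c k * l + c i * l = l * (c k + c i) by ring.
rewrite ler_pM2l//; have := dux i pi; have := dux k pk; rewrite !ler_norml.
move=> /andP[xk _] /andP[_ xi].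
have := ler_wpM2l (ltW (c0 k pk)) xi; have := ler_wpM2l (ltW (c0 i pi)) xk.
by clearbody c; lra.
Qed.

(** One inclusion is [polar_dot_le]. For the other, the first-order condition bounds the support
    function of the zonogon by 1 at each [y i]. *)
Lemma polarE p y : simplex p -> 0 < qform (cross_mx y) p ->
  (forall q, simplex q -> qform (cross_mx y) q <= qform (cross_mx y) p) ->
  polar y = zonogon (rotated p y (qform (cross_mx y) p)).
Proof.
move=> pS l0 pmax; have [p0 _] := pS.
have ple := qform_max_le _ _ pS (ltW l0) pmax.
have {}ple i : \sum_j p j * cross_mx y i j <= qform (cross_mx y) p.
  apply: ple => [j|j k]; rewrite /cross_mx.
    by rewrite /cross [X in X - _]mulrC subrr normr0.
  by rewrite -normrN; congr `|_|; rewrite /cross; ring.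
apply/seteqP; split=> [x xP z|x xZ i].
  rewrite support_rotated// ler_pdivlMr// mulrC.
  by apply: polar_dot_le => // i; exact: (qform_max_eq ple pS).
have H z : dot z x <= (\sum_j p j * `|cross z (y j)|) / qform (cross_mx y) p.
  by have := xZ z; rewrite support_rotated.
have h1 : (\sum_j p j * `|cross (y i) (y j)|) / qform (cross_mx y) p <= 1.
  by rewrite ler_pdivrMr// mul1r; exact: ple.
rewrite ler_norml; apply/andP; split; last exact: le_trans (H _) h1.
rewrite lerNl; have -> : - dot (y i) x = dot (- (y i).1, - (y i).2) x by rewrite /dot/=; ring.
apply: le_trans (H _) (le_trans _ h1); rewrite ler_pM2r ?invr_gt0//.
apply: ler_sum => j _; rewrite le_eqVlt; apply/orP; left; apply/eqP.
by congr (_ * _); rewrite -normrN; congr `|_|; rewrite /cross/=; ring.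
Qed.

End Polar.

(** * The area of the polar polygon *)

Section PolarArea.
Context {R : realType}.
Local Notation mu2 := (@lebesgue_measure2 R).

Lemma measurable_strip (y : R * R) : measurable [set x : R * R | `|dot y x| <= 1].
Proof.
have -> : [set x : R * R | `|dot y x| <= 1] =
    [set x | dot y x <= 1] `&` [set x | dot (- y.1, - y.2) x <= 1].
  apply/seteqP; split=> x /=.
    by rewrite ler_norml /dot/= => /andP[? ?]; split; lra.
  by rewrite ler_norml /dot/= => -[? ?]; apply/andP; split; lra.
by apply: measurableI; exact: measurable_halfplane.
Qed.

Lemma measurable_polar n (y : 'I_n -> R * R) : measurable (polar y).
Proof.
have -> : polar y = \bigcap_(i in [set: 'I_n]) [set x | `|dot (y i) x| <= 1].
  by apply/seteqP; split=> x xP i; [move=> _; exact: xP|exact: xP].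
by apply: fin_bigcap_measurable => [|i _]; [exact: finite_finset|exact: measurable_strip].
Qed.

(** [p] is a maximizer of the form; [q] certifies that the maximum is positive. *)
Lemma mu2_polar n (y : 'I_n -> R * R) q : simplex q -> 0 < qform (cross_mx y) q ->
  exists p, [/\ simplex p, qform (cross_mx y) q <= qform (cross_mx y) p &
    mu2 (polar y) = (2 / qform (cross_mx y) p)%:E].
Proof.
move=> qS q0; have n0 : (0 < n)%N.
  by case: n y q qS q0 => // y q [_]; rewrite big_ord0 => /esym/eqP; rewrite oner_eq0.
have [p [pS pmax]] := qform_max (cross_mx y) n0.
have p0 : 0 < qform (cross_mx y) p := lt_le_trans q0 (pmax q qS).
exists p; split=> //; first exact: pmax.
by rewrite (polarE pS)// mu2_rotated//; case: pS.
Qed.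

Lemma qform_gt0 n (y : 'I_n -> R * R) i j : cross (y i) (y j) != 0 ->
  exists q, simplex q /\ 0 < qform (cross_mx y) q.
Proof.
move=> yij; have n0 : 0 < n%:R :> R by rewrite ltr0n; case: n i {j y yij} => // -[].
exists (fun=> n%:R^-1); split; first split=> [k|]; first by rewrite invr_ge0 ltW.
  by rewrite sumr_const card_ord -[LHS]mulr_natl divff// gt_eqF.
have t0 k l : 0 <= n%:R^-1 * n%:R^-1 * cross_mx y k l 
  by apply: mulr_ge0; [rewrite mulr_ge0 ?invr_ge0 ?ltW|exact: normr_ge0].
rewrite /qform (bigD1 i)//= (bigD1 j)//=.
rewrite ltr_pwDl//; last by apply: sumr_ge0 => k _; exact: sumr_ge0.
rewrite ltr_pwDl//; last exact: sumr_ge0.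
by apply: mulr_gt0; [rewrite mulr_gt0 ?invr_gt0|rewrite normr_gt0].
Qed.

End PolarArea.

(** * The extension as a supremum of seminorms *)

Section Extension.
Context {R : realType} {V : finNormedModType R}.
Implicit Types (f g : 'Hom(V, R^o)) (s : ext2 V).
Local Notation mu2 := (@lebesgue_measure2 R).

Definition dual_ball f := forall x, (f x : R) <= `|x|.

(* The value at [s] of the 2-form [f /\ g]. *)
Definition pairing f g s : R := g (val s f).

Lemma pairing_wedge f g v w :
  pairing f g (wedge v w) = cross (f v, f w) (g v, g w).
Proof.
by rewrite /pairing /= wedge_tensorE linearB !linearZ /cross/= -mulrN.
Qed.

Lemma pairingP f g (a b : R) s t :
  pairing f g (a *: s + b *: t) = a * pairing f g s + b * pairing f g t.
Proof.
rewrite /pairing.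
have -> : val (a *: s + b *: t) = a *: val s + b *: val t by [].
by rewrite add_lfunE !scale_lfunE linearD !linearZ.
Qed.

Lemma dual_ball_norm f x : dual_ball f -> `|f x : R| <= `|x|.
Proof.
move=> fB; rewrite ler_norml fB andbT lerNl.
have -> : - (f x : R) = f (- x) by rewrite linearN.
by rewrite -(normrN x) fB.
Qed.

(** Writing [s] as a combination of wedges gives a bound uniform in [f] and [g], which makes the
    supremum finite. *)
Lemma pairing_bounded s : exists C, 0 <= C /\
  forall f g, dual_ball f -> dual_ball g -> `|pairing f g s| <= C.
Proof.
have [n [c [v [w ->]]]] := ext2_spanned s.
exists (\sum_i `|c i| * (2 * (`|v i| * `|w i|))); split=> [|f g fB gB].
  by apply: sumr_ge0 => i _; rewrite !mulr_ge0.
have -> : pairing f g (\sum_i c i *: wedge (v i) (w i)) =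
    \sum_i c i * pairing f g (wedge (v i) (w i)).
  apply: (big_ind2 (fun t r => pairing f g t = r)) => [|x1 x2 y1 y2 <- <-|i _].
  - by rewrite /pairing /= zero_lfunE linear0.
  - by have := pairingP f g 1 1 x1 y1; rewrite !scale1r !mul1r.
  - have := pairingP f g (c i) 0 (wedge (v i) (w i)) 0.
    by rewrite scale0r addr0 mul0r addr0.
apply: le_trans (ler_norm_sum _ _ _) _; apply: ler_sum => i _.
rewrite normrM ler_wpM2l// pairing_wedge /cross/=.
apply: le_trans (ler_normB _ _) _; rewrite !normrM mulrDl mul1r.
apply: lerD; first by apply: ler_pM => //; exact: dual_ball_norm.
by rewrite mulrC; apply: ler_pM => //; exact: dual_ball_norm.
Qed.

Definition pairing_mx n (f : 'I_n -> 'Hom(V, R^o)) s i j := `|pairing (f i) (f j) s|.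

Definition bh_values s : set R := [set r | exists n (p : 'I_n -> R) (f : 'I_n -> 'Hom(V, R^o)),
  [/\ simplex p, forall i, dual_ball (f i) & r = pi / 2 * qform (pairing_mx f s) p]].

Definition bh_extension s : R := sup (bh_values s).

Lemma bh_values0 s : bh_values s 0.
Proof.
exists 1%N, (fun=> 1), (fun=> 0); split=> [|_ x|].
- by split=> [i|]; rewrite ?ler01// big_ord_recl big_ord0 addr0.
- by rewrite zero_lfunE.
- rewrite /qform !big_ord_recl !big_ord0 !addr0 /pairing_mx /pairing zero_lfunE.
  by rewrite normr0 !mulr0.
Qed.

Lemma has_sup_bh_values s : has_sup (bh_values s).
Proof.
split; first by exists 0; exact: bh_values0.
have [C [C0 fgC]] := pairing_bounded s.
exists (pi / 2 * C) => _ [n [p [f [[p0 p1] fB ->]]]].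
rewrite ler_wpM2l ?divr_ge0 ?pi_ge0//.
have -> : C = \sum_i \sum_j p i * p j * C.
  under eq_bigr do rewrite -mulr_suml -mulr_sumr p1 mulr1.
  by rewrite -mulr_suml p1 mul1r.
by do 2!apply: ler_sum => ? _; rewrite ler_wpM2l ?mulr_ge0// fgC.
Qed.

Lemma bh_extension_convex : convex_function [set: ext2 V] bh_extension.
Proof.
move=> t x y _ _; rewrite convRE.
rewrite [X in bh_extension X <= _](_ : _ =
  (t%:num : R) *: (x : ext2 V) + (1 - t%:num) *: (y : ext2 V))//.
have t0 : 0 <= t%:num :> R by [].
have t1 : 0 <= 1 - t%:num :> R by rewrite subr_ge0.
move: (t%:num : R) t0 t1 => a a0 a1.
apply: ge_sup => [|_ [n [p [f [pS fB ->]]]]]; first by exists 0; exact: bh_values0.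
have H s : pi / 2 * qform (pairing_mx f s) p <= bh_extension s.
  by apply: ub_le_sup; [case: (has_sup_bh_values s)|exists n, p, f].
have := ler_wpM2l a0 (H x); have := ler_wpM2l a1 (H y).
suff : qform (pairing_mx f (a *: (x : ext2 V) + (1 - a) *: (y : ext2 V))) p <=
    a * qform (pairing_mx f x) p + (1 - a) * qform (pairing_mx f y) p.
  have := ler_wpM2l (ltW (divr_gt0 (pi_gt0 R) (ltr0n R 2))).
  by move=> /[apply]; rewrite /unstable.onem; lra.
rewrite !mulr_sumr -big_split/=; apply: ler_sum => i _.
rewrite !mulr_sumr -big_split/=; apply: ler_sum => j _.
have [p0 _] := pS.
have -> : a * (p i * p j * pairing_mx f x i j) + (1 - a) * (p i * p j * pairing_mx f y i j)
  = p i * p j * (a * pairing_mx f x i j + (1 - a) * pairing_mx f y i j) by ring.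
rewrite ler_wpM2l ?mulr_ge0// /pairing_mx pairingP.
by apply: le_trans (ler_normD _ _) _; rewrite !normrM (ger0_norm a0) (ger0_norm a1).
Qed.

End Extension.

(** * Sections of the unit ball, and the degenerate case *)

Section PlaneSection.
Context {R : realType} {V : finNormedModType R} (v1 v2 : V).
Local Notation mu2 := (@lebesgue_measure2 R).
Local Notation L := (plane_map v1 v2).

Definition ball_section : set (R * R) := L @^-1` unit_ball.

Definition pullback (f : 'Hom(V, R^o)) : R * R := (f v1, f v2).

Lemma dot_pullback f x : dot (pullback f) x = f (L x).
Proof. by rewrite /plane_map linearD !linearZ /dot/= mulrC [X in _ + X]mulrC. Qed.

Lemma plane_mapP (a : R) (x y : (R^o * R^o)%type) : L (a *: x + y) = a *: L x + L y.
Proof.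
rewrite /plane_map /= !scalerDl !scalerDr !scalerA.
by rewrite addrACA.
Qed.

Lemma plane_norm_sublinear : sublinear (fun x : (R^o * R^o)%type => `|L x|).
Proof.
split=> [x y|a x a0].
  by have := plane_mapP 1 x y; rewrite !scale1r => ->; exact: ler_normD.
have := plane_mapP a x 0; rewrite addr0 => ->.
have -> : L 0 = 0 by rewrite /plane_map /= !scale0r addr0.
by rewrite addr0 normrZ ger0_norm.
Qed.

Lemma norming_functional (x : V) :
  exists f : 'Hom(V, R^o), dual_ball f /\ (f x : R) = `|x|.
Proof.
apply: (@hahn_banach R V (fun x => `|x|)); split=> [u v|a u a0]; first exact: ler_normD.
by rewrite normrZ ger0_norm.
Qed.

(** Functionals norming the images of the rational points suffice, by density. *)
Lemma ball_sectionE : exists g : nat -> 'Hom(V, R^o), (forall k, dual_ball (g k)) /\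
  ball_section = \bigcap_k [set x | `|dot (pullback (g k)) x| <= 1].
Proof.
have [g gP] := choice (fun k => norming_functional (L (rat_point k))).
exists g; split=> [k|]; first by case: (gP k).
apply/seteqP; split=> [x xK k _ /=|x xP].
  rewrite dot_pullback; apply: le_trans (dual_ball_norm _ _) xK.
  by case: (gP k).
rewrite /ball_section /= /unit_ball /= leNgt; apply/negP => x1.
(* Half the excess: the approximation error is paid once in the norm and once in [g k]. *)
have d0 : 0 < (`|L x| - 1) / 2 by rewrite divr_gt0// subr_gt0.
have [k [k1 k2]] := rat_point_dense x plane_norm_sublinear d0.
have [gB gk] := gP k.
have := xP k I; rewrite /= dot_pullback leNgt => /negP; apply.
have LB (u v : (R^o * R^o)%type) : L u = L v + L (u - v).
  by have := plane_mapP 1 v (u - v); rewrite !scale1r addrC subrK => ->.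
apply: lt_le_trans (ler_norm _).
have -> : g k (L x) =
    g k (L (rat_point k)) + g k (L ((x : (R^o * R^o)%type) - rat_point k)) :> R.
  by rewrite -linearD -LB.
rewrite gk.
have h1 : `|L x| <= `|L (rat_point k)| + `|L ((x : (R^o * R^o)%type) - rat_point k)|.
  by rewrite [in leLHS](LB x (rat_point k)); exact: ler_normD.
have := dual_ball_norm (L ((x : (R^o * R^o)%type) - rat_point k)) gB.
by rewrite ler_norml => /andP[h2 _]; lra.
Qed.

Lemma measurable_ball_section : measurable ball_section.
Proof.
have [g [_ ->]] := ball_sectionE.
by apply: bigcapT_measurable => k; exact: measurable_strip.
Qed.

Lemma pairing_mx_wedge n (f : 'I_n -> 'Hom(V, R^o)) :
  pairing_mx f (wedge v1 v2) = cross_mx (pullback \o f).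
Proof. by apply/funext => i; apply/funext => j; rewrite /pairing_mx pairing_wedge. Qed.

Lemma ball_section_sub n (f : 'I_n -> 'Hom(V, R^o)) :
  (forall i, dual_ball (f i)) -> ball_section `<=` polar (pullback \o f).
Proof.
move=> fB x xK i; rewrite /= dot_pullback.
exact: le_trans (dual_ball_norm _ (fB i)) xK.
Qed.

(** The section lies in the polar polygon of the functionals, whose area [2 / l] is at most
    [2 / q]. *)
Lemma bh_values_upper r : bh_values (wedge v1 v2) r -> (r%:E * mu2 ball_section <= pi%:E)%E.
Proof.
move=> [n [p [f [pS fB ->]]]]; rewrite pairing_mx_wedge.
set q := qform _ _; have [p0 _] := pS.
have q0 : 0 <= q.
  by do 2!apply: sumr_ge0 => ? _; rewrite mulr_ge0 ?mulr_ge0 ?normr_ge0.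
have pi0 := pi_gt0 R.
have [->|qn0] := eqVneq q 0; first by rewrite mulr0 mul0e lee_fin ltW.
have qp : 0 < q by rewrite lt_neqAle eq_sym qn0.
have [p' [p'S qp' E]] := mu2_polar pS qp.
have p'0 := lt_le_trans qp qp'.
apply: (@le_trans _ _ ((pi / 2 * q)%:E * mu2 (polar (pullback \o f)))%E).
  rewrite lee_wpmul2l ?lee_fin ?mulr_ge0 ?divr_ge0 ?(ltW pi0)//.
  apply: (@le_measure _ _ _ (lebesgue_measure \x lebesgue_measure)%E); rewrite ?inE.
  - exact: measurable_ball_section.
  - exact: measurable_polar.
  - exact: ball_section_sub.
rewrite E -EFinM lee_fin; set l := qform _ p' in qp' p'0 *.
have -> : pi / 2 * q * (2 / l) = pi * (q / l) by field; rewrite gt_eqF.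
by rewrite ler_piMr ?(ltW pi0)// ler_pdivrMr// mul1r.
Qed.

(** The section contains a strip along [x], hence rectangles of arbitrarily large area. *)
Lemma mu2_ball_section_dependent (x : R * R) : x != 0 -> L x = 0 ->
  mu2 ball_section = +oo%E.
Proof.
move=> x0 Lx; apply/eqyP => A A0.
have N0 : 0 < x.1 ^+ 2 + x.2 ^+ 2.
  rewrite lt_neqAle addr_ge0 ?sqr_ge0// andbT eq_sym; apply: contra x0.
  rewrite paddr_eq0 ?sqr_ge0// !sqrf_eq0 => /andP[/eqP x1 /eqP x2].
  by rewrite [x]surjective_pairing x1 x2.
pose e : R * R := (- x.2, x.1).
(* [d] keeps the image of [d * e] in the unit ball, and [c] makes the cross product of the two
   generators equal to [A]; the rectangle then has area [4 * A]. *)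
pose d := (1 + `|L e|)^-1.
have d0 : 0 < d by rewrite invr_gt0 ltr_pwDl.
pose c := A / (d * (x.1 ^+ 2 + x.2 ^+ 2)).
have c0 : 0 < c by rewrite divr_gt0// mulr_gt0.
pose ws := [:: (c * x.1, c * x.2); (d * e.1, d * e.2)].
have wsK : zonogon ws `<=` ball_section.
  move=> z /zonogon_cons[s [_ /zonogon_cons[t [t1 zN]]]].
  have {zN} [z1 z2] : z.1 = s * (c * x.1) + t * (d * e.1) /\
      z.2 = s * (c * x.2) + t * (d * e.2).
    move: zN => /= zN; have := zN (1, 0); have := zN (-1, 0).
    by have := zN (0, 1); have := zN (0, -1); rewrite !big_nil /dot/=; lra.
  rewrite /ball_section/= /unit_ball/=.
  have -> : L z = (s * c) *: L x + (t * d) *: L e.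
    by rewrite /plane_map z1 z2 !scalerDl !scalerDr !scalerA -!mulrA addrACA.
  rewrite Lx scaler0 add0r normrZ normrM (gtr0_norm d0) -mulrA mulr_ile1//.
  - by rewrite mulr_ge0// ltW.
  - by rewrite /d ler_pdivrMl ?ltr_pwDl// mulr1 lerDr.
apply: (@le_trans _ _ (mu2 (zonogon ws))); last first.
  apply: (@le_measure _ _ _ (lebesgue_measure \x lebesgue_measure)%E); rewrite ?inE//.
  - exact: measurable_zonogon.
  - exact: measurable_ball_section.
rewrite mu2_zonogon lee_fin !big_cons !big_nil !addr0.
have cr (u : R * R) : cross u u = 0 by rewrite /cross; ring.
have -> : cross (d * e.1, d * e.2) (c * x.1, c * x.2) = - A.
  by rewrite /cross /c /e /=; field; rewrite !gt_eqF.
have -> : cross (c * x.1, c * x.2) (d * e.1, d * e.2) = A.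
  by rewrite /cross /c /e /=; field; rewrite !gt_eqF.
by rewrite !cr normr0 normrN (gtr0_norm A0); lra.
Qed.

(** All pulled-back functionals are orthogonal to [x], so they are pairwise parallel and every
    [cross] vanishes. *)
Lemma bh_extension_dependent (x : R * R) : x != 0 -> L x = 0 ->
  bh_extension (wedge v1 v2) = 0.
Proof.
move=> x0 Lx; rewrite /bh_extension (_ : bh_values _ = [set 0]) ?sup1//.
apply/seteqP; split=> [_ [n [p [f [_ _ ->]]]]|_ ->]; last exact: bh_values0.
rewrite pairing_mx_wedge /qform big1 ?mulr0// => i _; rewrite big1// => j _.
suff -> : cross_mx (pullback \o f) i j = 0 by rewrite mulr0.
rewrite /cross_mx /=; set u := pullback (f i); set w := pullback (f j).
have ux : dot u x = 0 by rewrite dot_pullback Lx linear0.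
have wx : dot w x = 0 by rewrite dot_pullback Lx linear0.
apply/eqP; rewrite normr_eq0; move: x0; apply: contraNT => uw.
have x1 : x.1 = 0.
  apply: (mulIf uw); rewrite mul0r.
  by transitivity (dot u x * w.2 - u.2 * dot w x);
    [rewrite /dot /cross; ring|rewrite ux wx; ring].
have x2 : x.2 = 0.
  apply: (mulIf uw); rewrite mul0r.
  by transitivity (u.1 * dot w x - dot u x * w.1);
    [rewrite /dot /cross; ring|rewrite ux wx; ring].
by rewrite [x]surjective_pairing x1 x2.
Qed.

End PlaneSection.

(** * The case of linearly independent vectors *)

Section IndependentPlane.
Context {R : realType} {V : finNormedModType R} (v1 v2 : V).
Local Notation mu2 := (@lebesgue_measure2 R).
Local Notation L := (plane_map v1 v2).
Local Notation K := (ball_section v1 v2).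
Context (L_inj : forall x : R * R, L x = 0 -> x = 0).

(** If all pullbacks were parallel, they would vanish at a common nonzero [x], and [K] would contain
    its whole line, including a point whose image has norm 2. *)
Lemma ball_section_cross (g : nat -> 'Hom(V, R^o)) :
  K = \bigcap_k [set x | `|dot (pullback v1 v2 (g k)) x| <= 1] ->
  exists i j, cross (pullback v1 v2 (g i)) (pullback v1 v2 (g j)) != 0.
Proof.
move=> KE; apply: contrapT => /forallNP nc.
have c0 i j : cross (pullback v1 v2 (g i)) (pullback v1 v2 (g j)) = 0.
  by apply/eqP; apply: contrapT => /negP ?; apply: (nc i); exists j.
have [x [x0 xP]] : exists x : R * R, x != 0 /\ forall k, dot (pullback v1 v2 (g k)) x = 0.
  have [[k yk]|/forallNP y0] := pselect (exists k, pullback v1 v2 (g k) != 0).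
    exists (- (pullback v1 v2 (g k)).2, (pullback v1 v2 (g k)).1); split=> [|i].
      apply: contra yk => /eqP[/eqP]; rewrite oppr_eq0 => /eqP y2 y1.
      by rewrite [pullback _ _ _]surjective_pairing; apply/eqP; congr pair.
    by rewrite -(c0 k i) /dot /cross /=; ring.
  exists (1, 0); split=> [|k].
    by apply/negP => /eqP[/eqP]; rewrite oner_eq0.
  have /negP := y0 k; rewrite negbK => /eqP ->.
  by rewrite /dot /=; ring.
have Lx : 0 < `|L x| by rewrite normr_gt0; apply: contra x0 => /eqP /L_inj ->.
pose t := 2 / `|L x|.
have : K (t * x.1, t * x.2).
  rewrite KE => k _ /=; set y := pullback _ _ _.
  have -> : dot y (t * x.1, t * x.2) = t * dot y x by rewrite /dot/=; ring.
  by rewrite xP mulr0 normr0.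
rewrite /ball_section/= /unit_ball/=.
have -> : L (t * x.1, t * x.2) = t *: L x.
  by rewrite /plane_map/= scalerDr !scalerA.
rewrite normrZ gtr0_norm ?divr_gt0// divfK ?gt_eqF//; lra.
Qed.

(** [bh_values_upper] gives one inequality. For the other, polygons of area at least [pi / P]
    decrease to [K]. Finiteness is stated as well because [fine] sends [+oo] to 0. *)
Lemma bh_extension_wedge :
  (bh_extension (wedge v1 v2) * fine (mu2 K))%:E = pi%:E /\ (mu2 K < +oo)%E.
Proof.
have [g [gB KE]] := ball_sectionE v1 v2.
have [i [j cij]] := ball_section_cross KE.
(* The offset [N] puts [i] and [j] into every family, so each form has a positive maximum. *)
pose N := maxn i j.
pose f n (k : 'I_(n + N).+1) := g k.
pose y n := pullback v1 v2 \o f n.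
set P := bh_extension _.
have polarN n : exists l, [/\ 0 < l, pi / 2 * l <= P & mu2 (polar (y n)) = (2 / l)%:E].
  have iN : (i < (n + N).+1)%N by rewrite ltnS (leq_trans (leq_maxl i j)) ?leq_addl.
  have jN : (j < (n + N).+1)%N by rewrite ltnS (leq_trans (leq_maxr i j)) ?leq_addl.
  have [q [qS q0]] := @qform_gt0 R _ (y n) (Ordinal iN) (Ordinal jN) cij.
  have [p [pS qp E]] := mu2_polar qS q0.
  exists (qform (cross_mx (y n)) p); split=> //; first exact: lt_le_trans qp.
  apply: ub_le_sup; first by case: (has_sup_bh_values (wedge v1 v2)).
  exists (n + N).+1, p, (f n); split=> // [k|]; first exact: gB.
  by rewrite pairing_mx_wedge.
have pi0 := pi_gt0 R.
have P0 : 0 < P.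
  by have [l [l0 lP _]] := polarN 0%N; apply: lt_le_trans lP; rewrite !mulr_gt0 ?invr_gt0.
have KF : K = \bigcap_n polar (y n).
  rewrite KE; apply/seteqP; split=> [x xP n _ k|x xP k _]; first exact: xP.
  have kN : (k < (k + N).+1)%N by rewrite ltnS leq_addr.
  exact: (xP k I (Ordinal kN)).
have mu0 : (mu2 (polar (y 0%N)) < +oo)%E.
  by have [l [_ _ ->]] := polarN 0%N; rewrite ltry.
(* Continuity from above, available because the first polygon has finite area. *)
have cvgK : (fun n => mu2 (polar (y n))) @ \oo --> mu2 K.
  rewrite KF; apply: (@nonincreasing_cvg_mu _ _ _ (lebesgue_measure \x lebesgue_measure)%E
    (fun n => polar (y n))) => //.
  - by move=> n; exact: measurable_polar.
  - by rewrite -KF; exact: measurable_ball_section.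
  - apply/nonincreasing_seqP => n; apply/subsetPset => x xP k.
    have kN : (k < (n.+1 + N).+1)%N by rewrite (leq_trans (ltn_ord k))// addSn.
    exact: (xP (Ordinal kN)).
have muK : (mu2 K < +oo)%E.
  apply: le_lt_trans mu0.
  apply: (@le_measure _ _ _ (lebesgue_measure \x lebesgue_measure)%E); rewrite ?inE.
  - exact: measurable_ball_section.
  - exact: measurable_polar.
  - by rewrite KF => x; apply.
have Kge : ((pi / P)%:E <= mu2 K)%E.
  rewrite -(cvg_lim _ cvgK)//; apply: lime_ge; first by apply/cvg_ex; eexists; exact: cvgK.
  near=> n; have [l [l0 lP ->]] := polarN n.
  rewrite lee_fin ler_pdivrMr// mulrAC ler_pdivlMr//; lra.
have Kfin : mu2 K \is a fin_num.
  by rewrite ge0_fin_numE//;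
    exact: (@measure_ge0 _ _ _ (lebesgue_measure \x lebesgue_measure)%E).
split=> //; move: Kge; rewrite -{1}(fineK Kfin) lee_fin ler_pdivrMr// mulrC => Kge.
have m0 : 0 < fine (mu2 K).
  by rewrite -(pmulr_rgt0 _ P0); exact: lt_le_trans Kge.
congr EFin; apply/eqP; rewrite eq_le Kge andbT -ler_pdivlMr//.
apply: ge_sup => [|r rP]; first by exists 0; exact: bh_values0.
have := bh_values_upper rP; rewrite -{1}(fineK Kfin) -EFinM lee_fin.
by rewrite ler_pdivlMr.
Unshelve. all: by end_near. Qed.

End IndependentPlane.

Theorem theorem1 (R : realType) (V : finNormedModType R) :
  exists Phi : ext2 V -> R,
    convex_function [set: ext2 V] Phi /\
    forall v1 v2 : V, (Phi (wedge v1 v2))%:E = bh_area v1 v2.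
Proof.
exists bh_extension; split=> [|v1 v2]; first exact: bh_extension_convex.
rewrite /bh_area -/(ball_section v1 v2).
(* For dependent vectors both sides are 0, the density through [pi / +oo = 0]. *)
have [[x [x0 Lx]]|nx] := pselect (exists x : R * R, x != 0 /\ plane_map v1 v2 x = 0).
  rewrite (bh_extension_dependent x0 Lx) (mu2_ball_section_dependent x0 Lx).
  by rewrite invey mule0.
have L_inj x : plane_map v1 v2 x = 0 -> x = 0.
  by move=> Lx; apply/eqP; apply: contrapT => /negP x0; apply: nx; exists x.
have [[E] Klt] := bh_extension_wedge L_inj.
have Kfin : lebesgue_measure2 (ball_section v1 v2) \is a fin_num.
  by rewrite ge0_fin_numE//;
    exact: (@measure_ge0 _ _ _ (lebesgue_measure \x lebesgue_measure)%E).
(* A section of measure 0 would contradict [E], as [pi > 0]. *)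
have m0 : fine (lebesgue_measure2 (ball_section v1 v2)) != 0.
  by apply/eqP => m0; have := pi_gt0 R; rewrite -E m0 mulr0 ltxx.
by rewrite -(fineK Kfin) inver (negPf m0) -EFinM -E mulfK.
Qed.
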